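(* Let $\mathcal A$ be a unital complex $C^*$-algebra and let $\mathscr E$ be a Hilbert $C^*$-module over $\mathcal A$ with $\mathcal A$-valued inner product $\langle\cdot|\cdot\rangle$ and norm $\|e\|=\|\langle e|e\rangle\|^{1/2}$. Let $e\in\mathscr E$, let $\mathscr F$ be a (complex linear) subspace of $\mathscr E$, and let $f_0\in\mathscr F$ be a best approximation to $e$ in $\mathscr F$, i.e. $\|e-f_0\|\le\|e-f\|$ for all $f\in\mathscr F$. For a state $\phi$ on $\mathcal A$, let $\mathcal L_\phi=\{x\in\mathscr E:\phi(\langle x|x\rangle)=0\}$, equip $\mathscr E/\mathcal L_\phi$ with the inner product $\langle e_1+\mathcal L_\phi\,|\,e_2+\mathcal L_\phi\rangle=\phi(\langle e_1|e_2\rangle)$, let $\mathscr F/\mathcal L_\phi=\{f+\mathcal L_\phi:f\in\mathscr F\}$, and define $$M_{e,\mathscr F}(\phi)=\sup\Big\{\phi\big(\langle e-f_0|e-f_0\rangle\big)-\sum_\alpha\big|\phi\big(\langle e-f_0|f_\alpha\rangle\big)\big|^2\Big\},$$ where the supremum is taken over all orthonormal bases $\{f_\alpha+\mathcal L_\phi\}$ (with $f_\alpha\in\mathscr F$) of $\mathscr F/\mathcal L_\phi$ in the inner product space $\mathscr E/\mathcal L_\phi$. Then $$\operatorname{dist}(e,\mathscr F)^2=\max\{M_{e,\mathscr F}(\phi):\phi\in S_{\mathcal A}\},$$ where $\operatorname{dist}(e,\mathscr F)=\inf\{\|e-f\|:f\in\mathscr F\}$ and $S_{\mathcal A}$ is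 the set of states on $\mathcal A$.
   Context: A state on a unital complex $C^*$-algebra $\mathcal A$ with identity $1_{\mathcal A}$ is a linear functional $\phi$ on $\mathcal A$ with $\phi(1_{\mathcal A})=1$ and $\phi(c)\ge 0$ for every positive element $c\in\mathcal A$. $S_{\mathcal A}$ denotes the set of all states on $\mathcal A$. *)

(* Defs.v *)
From HB Require Import structures.
From mathcomp Require Import all_boot all_order all_algebra.
From mathcomp Require Import all_classical all_reals.
From mathcomp Require Import ereal esum.
From mathcomp Require Import complex.
Set Implicit Arguments. Unset Strict Implicit. Unset Printing Implicit Defensive.
Import Order.TTheory GRing.Theory Num.Theory.
Local Open Scope ring_scope.
Local Open Scope classical_set_scope.

Section CstarDefs.
Variable R : realType.
Local Notation C := R[i].

Section Alg.
Variables (A : algType C) (star : A -> A) (nrm : A -> R).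

Definition invertible (a : A) := exists b : A, b * a = 1 /\ a * b = 1.

Definition positive (c : A) :=
  star c = c /\ forall l : C, ~ invertible (c - l%:A) -> 0 <= l.

Definition nrm_cauchy (u : nat -> A) :=
  forall eps : R, 0 < eps -> exists N : nat, forall m n : nat,
    (N <= m)%N -> (N <= n)%N -> nrm (u m - u n) < eps.

Definition nrm_converges (u : nat -> A) (l : A) :=
  forall eps : R, 0 < eps -> exists N : nat, forall n : nat,
    (N <= n)%N -> nrm (u n - l) < eps.

Record is_cstar_algebra : Prop := {
  star_add : forall x y, star (x + y) = star x + star y;
  star_scale : forall (k : C) x, star (k *: x) = Num.conj k *: star x;
  star_mul : forall x y, star (x * y) = star y * star x;
  star_invol : forall x, star (star x) = x;
  nrm_ge0 : forall x, 0 <= nrm x;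
  nrm_eq0 : forall x, nrm x = 0 -> x = 0;
  nrm_triangle : forall x y, nrm (x + y) <= nrm x + nrm y;
  nrm_scale : forall (k : C) x, ((nrm (k *: x))%:C)%C = `|k| * ((nrm x)%:C)%C;
  nrm_submul : forall x y, nrm (x * y) <= nrm x * nrm y;
  nrm_cstar : forall x, nrm (star x * x) = nrm x ^+ 2;
  nrm_complete : forall u, nrm_cauchy u -> exists l, nrm_converges u l }.

Definition is_state (phi : A -> C) :=
  (forall x y, phi (x + y) = phi x + phi y) /\
  (forall (k : C) x, phi (k *: x) = k * phi x) /\
  phi 1 = 1 /\
  (forall c, positive c -> 0 <= phi c).

Section Module.
Variables (E : lmodType C) (act : E -> A -> E) (ip : E -> E -> A).

Definition hnorm (x : E) : R := Num.sqrt (nrm (ip x x)).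

Record is_hilbert_module : Prop := {
  act_addl : forall x y a, act (x + y) a = act x a + act y a;
  act_addr : forall x a b, act x (a + b) = act x a + act x b;
  act_mul : forall x a b, act x (a * b) = act (act x a) b;
  act_one : forall x, act x 1 = x;
  act_scalel : forall (k : C) x a, act (k *: x) a = k *: act x a;
  act_scaler : forall (k : C) x a, act x (k *: a) = k *: act x a;
  ip_addr : forall x y z, ip x (y + z) = ip x y + ip x z;
  ip_scaler : forall (k : C) x y, ip x (k *: y) = k *: ip x y;
  ip_actr : forall x y a, ip x (act y a) = ip x y * a;
  ip_adj : forall x y, ip y x = star (ip x y);
  ip_pos : forall x, positive (ip x x);
  ip_eq0 : forall x, ip x x = 0 -> x = 0;
  hnorm_complete : forall u : nat -> E,
    (forall eps : R, 0 < eps -> exists N : nat, forall m n : nat,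
       (N <= m)%N -> (N <= n)%N -> hnorm (u m - u n) < eps) ->
    exists l, forall eps : R, 0 < eps -> exists N : nat, forall n : nat,
       (N <= n)%N -> hnorm (u n - l) < eps }.

Definition lin_subspace (F : set E) :=
  F 0 /\ (forall x y, F x -> F y -> F (x + y)) /\
  (forall (k : C) x, F x -> F (k *: x)).

Definition dist (e : E) (F : set E) : R := inf [set hnorm (e - f) | f in F].

(* S is a set of representatives f_alpha in F whose classes f_alpha + L_phi
   form an orthonormal family in E / L_phi, with inner product phi(<.|.>) *)
Definition orthonormal (phi : A -> C) (F S : set E) :=
  S `<=` F /\
  forall x y, S x -> S y -> phi (ip x y) = (x == y)%:R.

Definition onb (phi : A -> C) (F S : set E) :=
  orthonormal phi F S /\
  forall S', orthonormal phi F S' -> S `<=` S' -> S' `<=` S.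

Definition cabs (z : C) : R := complex.Re `|z|.

Definition Mfun (e f0 : E) (F : set E) (phi : A -> C) : \bar R :=
  ereal_sup [set ((complex.Re (phi (ip (e - f0) (e - f0))))%:E -
                  \esum_(x in S) ((cabs (phi (ip (e - f0) x))) ^+ 2)%:E)%E
            | S in [set S | onb phi F S]].

End Module.
End Alg.
End CstarDefs.

(* Main.v *)
(* Put u = e - f0 and c = <u|u>.  Every state phi satisfies phi c <= |c|, since
   |c| - c is positive; as dist(e, F)^2 = |c|, this bounds M from above.  The
   maximum is attained at any state with phi c = |c| and phi <u|f> = 0 on F.
   Expanding |u + t f|^2 >= |u|^2 to first order in t gives
   |c + s + Re <u|f>| >= |c| + s for all s >= 0, so the Hahn-Banach theorem
   yields a real-linear functional dominated by the norm which is at least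
   s |c| + s' at s c + s' + Re <u|f>; its complexification is such a state.

   The spectral input is that |a| or -|a| is in the spectrum of a self-adjoint
   a.  For |a| = 1, if 1 - a^2 had an inverse k, then with small eps the element
   q = sqrt(1 - a^2) sqrt(1 - eps k) commutes with a and z = a + i q satisfies
   z^* z = 1 - eps, whence |a| = |z + z^*| / 2 <= |z| < 1. *)

Require Import Defs.
From HB Require Import structures.
From mathcomp Require Import all_boot all_order all_algebra.
From mathcomp Require Import all_classical all_reals.
From mathcomp Require Import ereal esum.
From mathcomp Require Import complex.
From mathcomp Require Import ring lra.
Set Implicit Arguments. Unset Strict Implicit. Unset Printing Implicit Defensive.
Import Order.TTheory GRing.Theory Num.Theory.
Local Open Scope ring_scope.
Local Open Scope classical_set_scope.

(** * Hahn-Banach theorem with a sublinear upper bound and a convex cone of lower bounds *)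

Section HahnBanach.
Variables (R : realType) (V : lmodType R[i]).
Implicit Types (p q : V -> R) (x y : V) (t : R).

(** The second inequality, used at both [t] and [t^-1], gives positive homogeneity. *)
Definition sublinear p :=
  (forall x y, p (x + y) <= p x + p y) /\
  (forall t x, 0 < t -> p (t%:C%C *: x) <= t * p x).

Definition real_linear p :=
  (forall x y, p (x + y) = p x + p y) /\
  (forall t x, p (t%:C%C *: x) = t * p x).

(** A pair [(k, m)] stands for the constraint [m <= psi k] on the functional [psi] sought;
    constraints may be added and scaled. *)
Definition convex_cone (G : set (V * R)) :=
  [/\ G (0, 0),
      forall k k' m m', G (k, m) -> G (k', m') -> G (k + k', m + m') &
      forall t k m, 0 < t -> G (k, m) -> G (t%:C%C *: k, t * m)].

Lemma scale_realK t x : 0 < t -> t%:C%C *: (t^-1%:C%C *: x) = x.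
Proof.
by move=> t0; rewrite scalerA -rmorphM /= divff ?gt_eqF// rmorph1 scale1r.
Qed.

Lemma sublinear0 p : sublinear p -> p 0 = 0.
Proof.
move=> [padd pscale]; have := padd 0 0; have := pscale 2^-1 0.
by rewrite invr_gt0 ltr0n addr0 scaler0 => /(_ isT); lra.
Qed.

Lemma sublinearN p x : sublinear p -> - p (- x) <= p x.
Proof.
by move=> sp; have := sp.1 x (- x); rewrite subrr sublinear0//; lra.
Qed.

(** For linear [psi], [psi x = psi (x + k) - psi k]. Hence [psi] lies below [p] and meets the
    constraints of a cone [G] exactly when it lies below this function. *)
Definition cone_inf p (G : set (V * R)) x :=
  inf [set p (x + km.1) - km.2 | km in G].

Section ConeInf.
Variables (p : V -> R) (G : set (V * R)).
Hypotheses (sp : sublinear p) (coneG : convex_cone G).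
Hypothesis Gp : forall k m, G (k, m) -> m <= p k.

Lemma cone_inf_le x k m : G (k, m) -> cone_inf p G x <= p (x + k) - m.
Proof.
move=> Gk; apply: ge_inf; last by exists (k, m).
(* The set is bounded below, as [m' <= p k' <= p (- x) + p (x + k')]. *)
exists (- p (- x)) => _ [[k' m'] Gk' <-] /=.
have := Gp Gk'; have := sp.1 (- x) (x + k').
by rewrite addKr; lra.
Qed.

Lemma le_cone_inf x r :
  (forall k m, G (k, m) -> r <= p (x + k) - m) -> r <= cone_inf p G x.
Proof.
case: coneG => G0 _ _ rle; apply: lb_le_inf; first by exists (p (x + 0) - 0), (0, 0).
by move=> _ [[k m] Gk <-]; exact: rle.
Qed.

Lemma cone_inf_le_id x : cone_inf p G x <= p x.
Proof. by case: coneG => G0 _ _; have := cone_inf_le x G0; rewrite addr0 subr0. Qed.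

Lemma cone_inf_sublinear : sublinear (cone_inf p G).
Proof.
case: (coneG) => G0 Gadd Gscale; split=> [x y|t x t0].
  rewrite -lerBlDr; apply: le_cone_inf => k m Gk.
  rewrite lerBlDr [leRHS]addrC -lerBlDr; apply: le_cone_inf => k' m' Gk'.
  have := cone_inf_le (x + y) (Gadd _ _ _ _ Gk Gk').
  have := sp.1 (x + k) (y + k').
  by rewrite addrACA; lra.
rewrite mulrC -ler_pdivrMr//; apply: le_cone_inf => k m Gk.
rewrite ler_pdivrMr//.
have := cone_inf_le (t%:C%C *: x) (Gscale _ _ _ t0 Gk).
by rewrite -scalerDr; have := sp.2 t (x + k) t0; lra.
Qed.

Lemma cone_inf_cone k m : G (k, m) -> cone_inf p G (- k) <= - m.
Proof.
by move=> /(cone_inf_le (- k)); rewrite addNr sublinear0// sub0r.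
Qed.

End ConeInf.

(** The pointwise infimum works; it is finite because [q x >= - q (- x) >= - p (- x)]. For
    subadditivity, the smaller of two members of the chain serves both arguments. *)
Lemma inf_chain_sublinear p (H : set (V -> R)) :
  H !=set0 -> (forall q, H q -> sublinear q /\ forall x, q x <= p x) ->
  (forall q q', H q -> H q' -> (forall x, q x <= q' x) \/ (forall x, q' x <= q x)) ->
  exists q, [/\ sublinear q, forall x, q x <= p x & forall q', H q' -> forall x, q x <= q' x].
Proof.
move=> [q0 Hq0] Hp Hc.
pose q x := inf [set q' x | q' in H].
have qle q' x : H q' -> q x <= q' x.
  move=> Hq'; apply: ge_inf; last by exists q'.
  exists (- p (- x)) => _ [q1 /Hp [sq1 q1p] <-].
  by have := sublinearN x sq1; have := q1p (- x); lra.
have leq r x : (forall q', H q' -> r <= q' x) -> r <= q x.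
  move=> rle; apply: lb_le_inf; first by exists (q0 x), q0.
  by move=> _ [q' Hq' <-]; exact: rle.
exists q; split => //; last by move=> q' Hq' x; exact: qle.
  split=> [x y|t x t0].
    rewrite -lerBlDr; apply: (leq) => q1 Hq1.
    rewrite lerBlDr [leRHS]addrC -lerBlDr; apply: (leq) => q2 Hq2.
    rewrite lerBlDr.
    case: (Hc _ _ Hq1 Hq2) => le12.
      have := (Hp _ Hq1).1.1 x y; have := le12 y; have := qle _ (x + y) Hq1; lra.
    have := (Hp _ Hq2).1.1 x y; have := le12 x; have := qle _ (x + y) Hq2; lra.
  rewrite mulrC -ler_pdivrMr//; apply: (leq) => q1 Hq1; rewrite ler_pdivrMr//.
  have := (Hp _ Hq1).1.2 t x t0; have := qle _ (t%:C%C *: x) Hq1; lra.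
by move=> x; apply: le_trans (qle _ x Hq0) _; exact: (Hp _ Hq0).2.
Qed.

Lemma minimal_sublinear p : sublinear p -> exists q,
  [/\ sublinear q, forall x, q x <= p x &
      forall q', sublinear q' -> (forall x, q' x <= q x) -> q' = q].
Proof.
move=> sp.
pose T := {q : V -> R | sublinear q /\ forall x, q x <= p x}.
(* The order is reversed, so that Zorn's maximal element is a minimal sublinear function. *)
pose le (q q' : T) := `[< forall x, sval q' x <= sval q x >].
have [| | | |[q [sq qp]] qmin] := @Zorn T le.
- by move=> q; apply/asboolP => x.
- move=> q1 q2 q3 /asboolP h1 /asboolP h2; apply/asboolP => x.
  exact: le_trans (h2 x) (h1 x).
- move=> [q1 H1] [q2 H2] /asboolP /= h1 /asboolP /= h2.
  have q12 : q1 = q2 by apply/funext => x; apply: le_anti; rewrite h1 h2.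
  by case: _ / q12 H2 {h1 h2} => H2; congr exist; exact: Prop_irrelevance.
- move=> H Hc; have [->|/set0P[t0 Ht0]] := eqVneq H set0.
    by exists (exist _ p (conj sp (fun x => lexx _))) => s [].
  have [| | |q [sq qp qH]] := @inf_chain_sublinear p [set sval t | t in H].
  + by exists (sval t0), t0.
  + by move=> _ [t Ht <-]; exact: svalP t.
  + move=> _ _ [t Ht <-] [t' Ht' <-].
    by case: (Hc _ _ Ht Ht') => /asboolP; [right|left].
  exists (exist _ q (conj sq qp)) => t Ht; apply/asboolP => x /=.
  by apply: qH; exists t.
exists q; split => // q' sq' q'q.
have q'p x : q' x <= p x by exact: le_trans (q'q x) (qp x).
apply: (congr1 sval (qmin (exist _ q' (conj sq' q'p)) _)).
by apply/asboolP => x; exact: q'q.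
Qed.

(** Take [q] minimal sublinear below [cone_inf p G]. Adding the ray of constraints through
    [(y, q y)] gives a sublinear function below [q], hence [q] itself; at [- y] this reads
    [q (- y) <= - q y]. So [q] is odd, and an odd sublinear function is real-linear. *)
Theorem hahn_banach_cone p (G : set (V * R)) :
  sublinear p -> convex_cone G -> (forall k m, G (k, m) -> m <= p k) ->
  exists psi, [/\ real_linear psi, forall x, psi x <= p x &
    forall k m, G (k, m) -> m <= psi k].
Proof.
move=> sp coneG Gp.
have sq1 := cone_inf_sublinear sp coneG Gp.
have [q [sq qq1 qmin]] := minimal_sublinear sq1.
have qN y : q (- y) = - q y.
  pose Gy : set (V * R) := [set km | exists2 t, 0 <= t & km = (t%:C%C *: y, t * q y)].
  have coneGy : convex_cone Gy.
    split.
    - by exists 0 => //; rewrite rmorph0 scale0r mul0r.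
    - move=> k k' m m' [t t0 [-> ->]] [t' t'0 [-> ->]]; exists (t + t').
        exact: addr_ge0.
      by rewrite rmorphD scalerDl mulrDl.
    - move=> s k m s0 [t t0 [-> ->]]; exists (s * t); first by rewrite mulr_ge0// ltW.
      by rewrite rmorphM -scalerA mulrA.
  have Gyq k m : Gy (k, m) -> m <= q k.
    move=> [t]; rewrite le_eqVlt => /predU1P[<- [-> ->]|t0 [-> ->]].
      by rewrite rmorph0 scale0r mul0r sublinear0.
    have := sq.2 t^-1 (t%:C%C *: y); have := @scale_realK t^-1 y.
    rewrite invrK invr_gt0 => /(_ t0) -> /(_ t0).
    by rewrite mulrC ler_pdivlMr// mulrC.
  have Gyy : Gy (y, q y) by exists 1 => //; rewrite rmorph1 scale1r mul1r.
  have eqq : cone_inf q Gy = q.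
    apply: qmin; first exact: cone_inf_sublinear.
    by move=> x; exact: cone_inf_le_id.
  apply/eqP; rewrite eq_le -{1}eqq cone_inf_cone//=.
  by rewrite lerNl sublinearN.
exists q; split.
- split=> [x y|t x].
    apply/eqP; rewrite eq_le sq.1 /=.
    by have := sq.1 (- x) (- y); rewrite -opprD !qN; lra.
  have qpos s z : 0 < s -> q (s%:C%C *: z) = s * q z.
    move=> s0; apply/eqP; rewrite eq_le sq.2//=.
    by have := sq.2 s (- z) s0; rewrite scalerN !qN; lra.
  have [t0|t0|->] := ltgtP t 0.
  + have := qpos (- t) x; rewrite oppr_gt0 => /(_ t0).
    by rewrite rmorphN scaleNr qN; lra.
  + exact: qpos.
  + by rewrite rmorph0 scale0r mul0r sublinear0.
- by move=> x; apply: le_trans (qq1 x) _; exact: cone_inf_le_id.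
- move=> k m Gk; rewrite -(opprK k) qN lerNr.
  by apply: le_trans (qq1 _) _; exact: cone_inf_cone.
Qed.

End HahnBanach.

(** * Norm and involution *)

Section CstarAlgebra.
Variables (R : realType) (A : algType R[i]) (star : A -> A) (nrm : A -> R).
Hypothesis cA : is_cstar_algebra star nrm.
Implicit Types (a b c x y : A) (r s t : R).

Lemma nrm_scale_real r x : nrm (r%:C%C *: x) = `|r| * nrm x.
Proof.
apply: (@complexI R); rewrite (nrm_scale cA) rmorphM /=; congr (_ * _).
by rewrite normc_def /= expr0n /= addr0 sqrtr_sqr.
Qed.

Lemma scaleN1_real x : (-1)%:C%C *: x = - x.
Proof. by rewrite rmorphN rmorph1 scaleN1r. Qed.

Lemma nrm0 : nrm 0 = 0.
Proof. by have := nrm_scale_real 0 0; rewrite scaler0 normr0 mul0r. Qed.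

Lemma nrmN x : nrm (- x) = nrm x.
Proof.
by rewrite -scaleN1_real nrm_scale_real normrN1 mul1r.
Qed.

Lemma nrm_distC x y : nrm (x - y) = nrm (y - x).
Proof. by rewrite -nrmN opprB. Qed.

Lemma star_scale_real r x : star (r%:C%C *: x) = r%:C%C *: star x.
Proof. by rewrite (star_scale cA) [Num.conj _]conjc_real. Qed.

Lemma star_scale_i x : star ('i%C *: x) = - 'i%C *: star x.
Proof. by rewrite (star_scale cA); congr (_ *: _); apply/eqP; rewrite eq_complex /= oppr0 !eqxx. Qed.

Lemma star0 : star 0 = 0.
Proof. by have := star_scale_real 0 0; rewrite rmorph0 !scale0r. Qed.

Lemma starN x : star (- x) = - star x.
Proof.
by rewrite -!scaleN1_real star_scale_real.
Qed.

Lemma starB x y : star (x - y) = star x - star y.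
Proof. by rewrite (star_add cA) starN. Qed.

Lemma star1 : star 1 = 1.
Proof. by have := star_mul cA (star 1) 1; rewrite mulr1 !(star_invol cA) mulr1. Qed.

(** The C*-identity makes [nrm 1] idempotent, and it is nonzero because [1 != 0] in [A]. *)
Lemma nrm1 : nrm 1 = 1.
Proof.
have := nrm_cstar cA 1; rewrite star1 mulr1 expr2 => /esym/eqP.
rewrite -subr_eq0 -{3}(mulr1 (nrm 1)) -mulrBr mulf_eq0 subr_eq0 => /orP[/eqP n10|/eqP //].
by have := oner_neq0 A; rewrite (nrm_eq0 cA n10) eqxx.
Qed.

Lemma nrm_real r : nrm (r%:C%C)%:A = `|r|.
Proof. by rewrite nrm_scale_real nrm1 mulr1. Qed.

(** From [nrm y ^+ 2 = nrm (star y * y) <= nrm (star y) * nrm y] one gets [nrm y <= nrm (star y)];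
    the involution gives the converse. *)
Lemma nrm_star x : nrm (star x) = nrm x.
Proof.
have half y : nrm y <= nrm (star y).
  have := nrm_cstar cA y; have := nrm_submul cA (star y) y.
  have [y0|] := ltP 0 (nrm y); last by have := nrm_ge0 cA (star y); lra.
  by move=> + E; rewrite E expr2 ler_pM2r.
by apply/eqP; rewrite eq_le half -{2}(star_invol cA x) half.
Qed.

Lemma nrm_re x : nrm (x + star x) <= 2 * nrm x.
Proof. by have := nrm_triangle cA x (star x); rewrite nrm_star; lra. Qed.

(** * Norm limits, the Neumann series and square roots *)

Lemma nrm_converges_unique u x y :
  nrm_converges nrm u x -> nrm_converges nrm u y -> x = y.
Proof.
move=> ux uy; apply/eqP; rewrite -subr_eq0; apply/eqP/(nrm_eq0 cA).
apply/eqP; rewrite eq_le (nrm_ge0 cA) andbT; apply/ler_addgt0Pl => eps eps0.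
have e20 : 0 < eps / 2 by rewrite divr_gt0.
have [N hN] := ux _ e20; have [N' hN'] := uy _ e20.
have := hN (maxn N N') (leq_maxl _ _); have := hN' (maxn N N') (leq_maxr _ _).
have := nrm_triangle cA (x - u (maxn N N')) (u (maxn N N') - y).
by rewrite subrKA (nrm_distC x); lra.
Qed.

(** The bound is asked only between [u n] and the limit, which suits the quadratic map iterated in
    [sqrt_1B]. *)
Lemma nrm_converges_lipschitz (f : A -> A) k u x :
  0 <= k -> (forall n, nrm (f (u n) - f x) <= k * nrm (u n - x)) ->
  nrm_converges nrm u x -> nrm_converges nrm (f \o u) (f x).
Proof.
move=> k0 fk ux eps eps0.
have k10 : 0 < k + 1 by lra.
have [N hN] := ux (eps / (k + 1)) (divr_gt0 eps0 k10).
exists N => n /hN; rewrite ltr_pdivlMr// => h; have := fk n.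
by have := nrm_ge0 cA (u n - x); rewrite /=; nra.
Qed.

Lemma nrm_convergesS u x :
  nrm_converges nrm u x -> nrm_converges nrm (fun n => u n.+1) x.
Proof.
by move=> ux eps /ux[N hN]; exists N => n Nn; apply: hN; exact: leqW.
Qed.

Lemma nrm_converges_mulr a u x :
  nrm_converges nrm u x -> nrm_converges nrm (fun n => u n * a) (x * a).
Proof.
apply: (@nrm_converges_lipschitz (fun y => y * a) (nrm a)); first exact: nrm_ge0 cA _.
by move=> n; rewrite -mulrBl mulrC; exact: nrm_submul cA _ _.
Qed.

Lemma nrm_converges_mull a u x :
  nrm_converges nrm u x -> nrm_converges nrm (fun n => a * u n) (a * x).
Proof.
apply: (@nrm_converges_lipschitz (fun y => a * y) (nrm a)); first exact: nrm_ge0 cA _.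
by move=> n; rewrite -mulrBr; exact: nrm_submul cA _ _.
Qed.

Lemma nrm_converges_star u x :
  nrm_converges nrm u x -> nrm_converges nrm (star \o u) (star x).
Proof.
by apply: (@nrm_converges_lipschitz star 1) => // n; rewrite -starB nrm_star mul1r.
Qed.

(** Telescoping bounds [nrm (u n - u m)] by [v n - v m] for [m <= n], and [v] is nondecreasing and
    bounded, hence eventually close to its supremum. *)
Lemma converges_of_majorant (u : nat -> A) (v : nat -> R) B :
  (forall n, nrm (u n.+1 - u n) <= v n.+1 - v n) -> (forall n, v n <= B) ->
  exists l, nrm_converges nrm u l.
Proof.
move=> uv vB.
have uvD n k : nrm (u (n + k)%N - u n) <= v (n + k)%N - v n.
  elim: k => [|k IH]; first by rewrite addn0 !subrr nrm0.
  have := nrm_triangle cA (u (n + k.+1)%N - u (n + k)%N) (u (n + k)%N - u n).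
  by rewrite subrKA addnS; have := uv (n + k)%N; lra.
have uvle m n : (m <= n)%N -> nrm (u n - u m) <= v n - v m.
  by move=> /subnKC <-; exact: uvD.
apply: nrm_complete cA _ _ => eps eps0.
have hs : has_sup (range v).
  by split; [exists (v 0%N), 0%N|exists B => _ [n _ <-]].
have [_ [N _ <-] hN] := sup_adherent eps0 hs.
have vsup n : v n <= sup (range v) by apply: sup_upper_bound => //; exists n.
exists N => m n Nm Nn.
have [mn|/ltnW nm] := leqP m n.
  rewrite nrm_distC; apply: le_lt_trans (uvle _ _ mn) _.
  by have := vsup n; have := uvle _ _ Nm; have := nrm_ge0 cA (u m - u N); lra.
apply: le_lt_trans (uvle _ _ nm) _.
by have := vsup m; have := uvle _ _ Nn; have := nrm_ge0 cA (u n - u N); lra.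
Qed.

(** The partial sums of the Neumann series are majorised by the geometric series. Their two
    recursions, with [x] on the left or on the right, make the limit a two-sided inverse. *)
Lemma invertible_1B x : nrm x < 1 -> invertible (1 - x).
Proof.
move=> x1; have x0 := nrm_ge0 cA x.
pose u n : A := \sum_(i < n) x ^+ i.
pose v n : R := \sum_(i < n) nrm x ^+ i.
have d0 : 0 < 1 - nrm x by lra.
have nrmX n : nrm (x ^+ n) <= nrm x ^+ n.
  elim: n => [|n IH]; first by rewrite !expr0 nrm1.
  rewrite !exprS; apply: le_trans (nrm_submul cA _ _) _.
  exact: ler_wpM2l.
have [||l ul] := @converges_of_majorant u v (1 - nrm x)^-1.
- by move=> n; rewrite /u /v !big_ord_recr /= !(addrC (\sum_(i < n) _)) !addrK.
- move=> n; rewrite -[leRHS]mul1r ler_pdivlMr// -[v n * _]opprK -mulrN opprB.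
  rewrite mulrC -subrX1 opprB.
  by rewrite gerBl exprn_ge0.
have uS n : u n.+1 = 1 + x * u n.
  rewrite /u big_ord_recl expr0 mulr_sumr; congr (_ + _).
  by apply: eq_bigr => i _; rewrite -exprS.
have uS' n : u n.+1 = 1 + u n * x.
  rewrite /u big_ord_recl expr0 mulr_suml; congr (_ + _).
  by apply: eq_bigr => i _; rewrite -exprSr.
have l1 : l = 1 + x * l.
  apply: nrm_converges_unique (nrm_convergesS ul) _; rewrite (funext uS).
  apply: (@nrm_converges_lipschitz (fun y => 1 + x * y) (nrm x)) => // n.
  by rewrite opprD addrACA subrr add0r -mulrBr; exact: nrm_submul cA _ _.
have l2 : l = 1 + l * x.
  apply: nrm_converges_unique (nrm_convergesS ul) _; rewrite (funext uS').
  apply: (@nrm_converges_lipschitz (fun y => 1 + y * x) (nrm x)) => // n.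
  by rewrite opprD addrACA subrr add0r -mulrBl mulrC; exact: nrm_submul cA _ _.
exists l; split; first by rewrite mulrBr mulr1 {1}l2 addrK.
by rewrite mulrBl mul1r {1}l1 addrK.
Qed.

(* The root is [1 - y] with [y] the limit of [y_(n+1) = (x + y_n ^ 2) / 2],
   which is majorised by the same scalar iteration started from [x = 1]. *)
Lemma sqrt_1B x : star x = x -> nrm x <= 1 -> exists s : A,
  [/\ star s = s, s * s = 1 - x & forall y, y * x = x * y -> y * s = s * y].
Proof.
move=> sx x1.
pose h : R[i] := (2^-1 : R)%:C%C.
have hh : h + h = 1 by rewrite -rmorphD -[in RHS](rmorph1 (real_complex R)); congr (_%:C)%C; lra.
have nh z : nrm (h *: z) = nrm z / 2 by rewrite nrm_scale_real ger0_norm ?invr_ge0// mulrC.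
pose u := fix u n : A := if n is n'.+1 then h *: (x + u n' * u n') else 0.
pose v := fix v n : R := if n is n'.+1 then (1 + v n' * v n') / 2 else 0.
have v01 n : 0 <= v n <= 1.
  by elim: n => [|n /andP[v0 v1]] /=; [rewrite lexx ler01|apply/andP; split; nra].
have uv n : nrm (u n) <= v n.
  elim: n => [|n IH]; first by rewrite /= nrm0.
  rewrite /= nh; have := nrm_triangle cA x (u n * u n).
  have := nrm_submul cA (u n) (u n); have := nrm_ge0 cA (u n); nra.
have comm_u n y : y * x = x * y -> y * u n = u n * y.
  move=> yx; elim: n => [|n IH] /=; first by rewrite mulr0 mul0r.
  by rewrite -scalerAr -scalerAl mulrDr mulrDl yx mulrA IH -mulrA IH mulrA.
have uu m n : u m * u n = u n * u m by apply: (comm_u); rewrite -(comm_u m).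
have sqB a b : a * b = b * a -> a * a - b * b = (a - b) * (a + b).
  by move=> ab; rewrite mulrDr !mulrBl -ab addrA addrNK.
(* Commutation lets the difference of squares factor. *)
have gB a b : a * b = b * a ->
    nrm (h *: (x + a * a) - h *: (x + b * b)) <= nrm (a - b) * (nrm a + nrm b) / 2.
  move=> ab; rewrite -scalerBr nh opprD addrACA subrr add0r sqB// ler_pM2r ?invr_gt0//.
  apply: le_trans (nrm_submul cA _ _) _; apply: ler_wpM2l; first exact: nrm_ge0 cA _.
  exact: nrm_triangle cA _ _.
have [|n|l ul] := @converges_of_majorant u v 1; last 1 first; last by case/andP: (v01 n).
- have comm_l y : y * x = x * y -> y * l = l * y.
    move=> yx; apply: nrm_converges_unique (nrm_converges_mull y ul) _.
    rewrite (funext (fun n => comm_u n y yx)).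
    exact: nrm_converges_mulr.
  have ll : l = h *: (x + l * l).
    apply: nrm_converges_unique (nrm_convergesS ul) _.
    (* The constant comes from [gB] and [nrm (u n) <= v n <= 1]. *)
    apply: (@nrm_converges_lipschitz (fun y => h *: (x + y * y)) ((1 + nrm l) / 2)) => //.
      by have := nrm_ge0 cA l; lra.
    move=> n; have /gB : u n * l = l * u n by apply: comm_l; rewrite comm_u.
    have := uv n; case/andP: (v01 n) => _ vn1 un1.
    by have := nrm_ge0 cA (u n - l); have := nrm_ge0 cA l; nra.
  have sl : star l = l.
    apply: nrm_converges_unique (nrm_converges_star ul) _.
    suff -> : star \o u = u by [].
    apply/funext; elim => [|n IH] /=; first exact: star0.
    rewrite star_scale_real (star_add cA) (star_mul cA) sx.
    by rewrite /= in IH; rewrite IH.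
  (* Since [l + l = x + l * l], the square of [1 - l] is [1 - x]. *)
  exists (1 - l); split.
  + by rewrite starB star1 sl.
  + have l2 : l + l = x + l * l.
      by rewrite {1 2}ll -scalerDl hh scale1r.
    have -> : x = l + l - l * l by rewrite l2 addrK.
    by rewrite mulrBr mulr1 mulrBl mul1r !opprD !opprK !addrA.
  + by move=> y yx; rewrite mulrBr mulrBl mulr1 mul1r comm_l.
(* For the scalar iteration the estimate [gB] is an equality: each increment is the previous one
   times [(v n.+1 + v n) / 2]. *)
- elim => [|n IH]; first by rewrite /= mul0r mulr0 !addr0 !subr0 nh; lra.
  have vS m : v m.+1 = (1 + v m * v m) / 2 by [].
  have uS m : u m.+1 = h *: (x + u m * u m) by [].
  rewrite (uS n.+1) {3}(uS n) (vS n.+1) {3}(vS n).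
  have := gB (u n.+1) (u n) (uu _ _).
  have : nrm (u n.+1 - u n) * (nrm (u n.+1) + nrm (u n)) <= (v n.+1 - v n) * (v n.+1 + v n).
    by apply: ler_pM; rewrite ?addr_ge0 ?lerD ?(nrm_ge0 cA).
  by lra.
Qed.

(** * Spectrum of self-adjoint and positive elements; bound for states *)

Lemma self_adjoint_1B_not_invertible a :
  star a = a -> nrm a = 1 -> ~ invertible (1 - a * a).
Proof.
move=> sa a1 [k [kr kl]].
have comm_k y : y * (a * a) = (a * a) * y -> y * k = k * y.
  move=> ya; have ya' : y * (1 - a * a) = (1 - a * a) * y by rewrite mulrBr mulrBl mulr1 mul1r ya.
  by rewrite -[LHS]mul1r -kr -mulrA (mulrA _ y) -ya' -(mulrA y) kl mulr1.
have s1 : star (1 - a * a) = 1 - a * a by rewrite starB star1 (star_mul cA) sa.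
have sk : star k = k.
  by rewrite -[LHS]mulr1 -kl mulrA -{1}s1 -(star_mul cA) kl star1 mul1r.
(* Small enough that [eps k] has norm at most 1, so that [1 - eps k] has a square root. *)
pose eps : R := (1 + nrm k)^-1.
have k0 := nrm_ge0 cA k.
have eps0 : 0 < eps by rewrite invr_gt0; lra.
have eps1 : eps <= 1 by rewrite invf_le1; lra.
have epsk : nrm (eps%:C%C *: k) <= 1.
  rewrite nrm_scale_real gtr0_norm// mulrC ler_pdivrMr; lra.
have [||s [ss s2 comm_s]] := @sqrt_1B (a * a); first by rewrite (star_mul cA) sa.
  by rewrite -{1}sa (nrm_cstar cA) a1 expr1n.
have [|t [st t2 comm_t]] := @sqrt_1B (eps%:C%C *: k) _ epsk.
  by rewrite star_scale_real sk.
have aas : a * s = s * a by apply: comm_s; rewrite mulrA.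
have comm_t' y : y * k = k * y -> y * t = t * y.
  by move=> yk; apply: comm_t; rewrite -scalerAr -scalerAl yk.
have at_ : a * t = t * a by apply/comm_t'/comm_k; rewrite mulrA.
have sst : s * t = t * s.
  by apply/comm_t'/comm_k; rewrite mulrA -aas -mulrA -aas mulrA.
pose q := s * t.
have sq : star q = q by rewrite (star_mul cA) ss st -sst.
have aq : a * q = q * a by rewrite /q mulrA aas -mulrA at_ mulrA.
(* [q ^ 2 = (1 - a ^ 2) (1 - eps k)], and [k] inverts the first factor. *)
have q2 : q * q = 1 - a * a - eps%:C%C%:A.
  rewrite /q mulrA -(mulrA s t) -sst mulrA s2 -mulrA t2 mulrBr mulr1.
  by rewrite -scalerAr kl.
pose z := a + 'i%C *: q.
have sz : star z = a - 'i%C *: q by rewrite (star_add cA) star_scale_i sa sq scaleNr.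
have zz : star z * z = (1 - eps)%:C%C%:A.
  rewrite sz /z mulrDr !mulrBl -!scalerAr -!scalerAl aq scalerA -(expr2 'i%C) sqr_i scaleN1r.
  rewrite q2 rmorphB rmorph1 scalerBl scale1r.
  by rewrite opprK addrA addrNK addrC addrAC subrK.
have := nrm_cstar cA z; rewrite zz nrm_real ger0_norm ?subr_ge0// => z2.
have : nrm (z + star z) <= 2 * nrm z by exact: nrm_re.
have -> : z + star z = (2 : R)%:C%C *: a.
  by rewrite sz addrACA addrN addr0 -mulr2n -scaler_nat rmorph_nat.
rewrite nrm_scale_real a1 mulr1 ger0_norm//.
by have := nrm_ge0 cA z; nra.
Qed.

Lemma invertibleM x y : invertible x -> invertible y -> invertible (x * y).
Proof.
move=> [x' [x'x xx']] [y' [y'y yy']]; exists (y' * x').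
by split; rewrite -mulrA [X in _ * X]mulrA ?x'x ?yy' mul1r.
Qed.

Lemma invertibleZ (k : R[i]) x : k != 0 -> invertible x -> invertible (k *: x).
Proof.
move=> k0 [x' [x'x xx']]; exists (k^-1 *: x').
by rewrite -!scalerAl -!scalerAr !scalerA divff// mulVf// !scale1r.
Qed.

(** With [r = nrm a] and [b = a / r], the element [1 - b ^ 2] is a nonzero multiple of
    [(a - r) (a + r)]; were both factors invertible, it would be too. *)
Lemma self_adjoint_nrm_spectrum a : star a = a -> 0 < nrm a ->
  ~ invertible (a - (nrm a)%:C%C%:A) \/ ~ invertible (a - (- nrm a)%:C%C%:A).
Proof.
move=> sa; set r := nrm a => r0; apply/not_andP => -[h1 h2].
have rn0 : r != 0 by rewrite gt_eqF.
pose b := r^-1%:C%C *: a.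
have sb : star b = b by rewrite star_scale_real sa.
have b1 : nrm b = 1 by rewrite nrm_scale_real ger0_norm ?invr_ge0 ?ltW// mulVf.
apply: (self_adjoint_1B_not_invertible sb b1).
have -> : 1 - b * b = (- r^-1)%:C%C *: ((a - r%:C%C%:A) * (r^-1%:C%C *: (a - (- r)%:C%C%:A))).
  have E : (a - r%:C%C%:A) * (a + r%:C%C%:A) = a * a - (r * r)%:C%C%:A.
    rewrite mulrDr !mulrBl -!scalerAl -!scalerAr !mul1r !mulr1 addrA subrK.
    by rewrite scalerA -rmorphM.
  have -> : b * b = (r^-1 * r^-1)%:C%C *: (a * a).
    by rewrite /b -scalerAl -scalerAr scalerA -rmorphM.
  rewrite !rmorphN !scaleNr opprK -scalerAr E !scalerBr !scalerA -!rmorphM /=.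
  by rewrite mulrA mulfVK// mulVf// rmorph1 scale1r opprB.
have rV0 : (r^-1)%:C%C != 0 by rewrite (inj_eq (@complexI R) _ 0) invr_eq0.
apply: invertibleZ; first by rewrite rmorphN oppr_eq0.
by apply: invertibleM => //; exact: invertibleZ.
Qed.

Lemma invertible_nrm_lt a (l : R[i]) : (nrm a)%:C%C < `|l| -> invertible (a - l%:A).
Proof.
move=> al; have l0 : 0 < `|l| by apply: le_lt_trans al; rewrite lecR (nrm_ge0 cA).
have ln0 : l != 0 by rewrite -normr_gt0.
have -> : a - l%:A = - l *: (1 - l^-1 *: a).
  by rewrite scalerBr scalerA mulNr divff// scaleN1r opprK scaleNr addrC.
apply: invertibleZ; first by rewrite oppr_eq0.
by apply: invertible_1B; rewrite -ltcR (nrm_scale cA) normfV mulrC ltr_pdivrMr// mul1r.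
Qed.

Lemma nrm_ge_real a r : 0 <= r -> ~ invertible (a - r%:C%C%:A) -> r <= nrm a.
Proof.
move=> r0; apply: contra_notT; rewrite -ltNge => ar; apply: invertible_nrm_lt.
by rewrite ger0_norm ?lecR ?ltcR.
Qed.

(** If [x = nrm c - c] had larger norm, the spectrum of [c] would contain [nrm c - nrm x < 0],
    against positivity, or [nrm c + nrm x > nrm c], against the norm bound. This later yields
    positivity of norm-dominated functionals. *)
Lemma positive_nrmB c : positive star c -> nrm ((nrm c)%:C%C%:A - c) <= nrm c.
Proof.
move=> [sc pc]; have c0 := nrm_ge0 cA c; rewrite leNgt; apply/negP => lt.
set x := _ - c in lt.
have sx : star x = x by rewrite starB star_scale_real star1 sc.
have [] := self_adjoint_nrm_spectrum sx (le_lt_trans c0 lt).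
  have -> : x - (nrm x)%:C%C%:A = -1 *: (c - (nrm c - nrm x)%:C%C%:A).
    by rewrite scaleN1r opprB rmorphB scalerBl /x addrAC.
  move=> h; have : ~ invertible (c - (nrm c - nrm x)%:C%C%:A).
    by apply: contra_not h => h; apply: invertibleZ => //; rewrite oppr_eq0 oner_eq0.
  by move=> /pc; rewrite lecR subr_ge0 leNgt lt.
apply; have -> : x - (- nrm x)%:C%C%:A = -1 *: (c - (nrm c + nrm x)%:C%C%:A).
  by rewrite scaleN1r opprB rmorphN rmorphD scaleNr scalerDl /x opprK addrAC.
apply: invertibleZ; first by rewrite oppr_eq0 oner_eq0.
by apply: invertible_nrm_lt; rewrite ger0_norm ?lecR ?ltcR; lra.
Qed.

(** For [c] nonzero, positivity keeps [- nrm c] out of the spectrum, so [nrm c] is in it; shifting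
    by [r] puts [nrm c + r] in the spectrum of [c + r]. *)
Lemma positive_nrmD c r : positive star c -> 0 <= r ->
  nrm c + r <= nrm (c + r%:C%C%:A).
Proof.
move=> [sc pc] r0; have := nrm_ge0 cA c; rewrite le_eqVlt => /predU1P[c0|c0].
  by rewrite -c0 (nrm_eq0 cA (esym c0)) !add0r nrm_real ger0_norm.
apply: nrm_ge_real; first by rewrite addr_ge0 // ltW.
rewrite rmorphD scalerDl opprD addrACA addrN addr0.
have [//|/pc] := self_adjoint_nrm_spectrum sc c0.
by rewrite lecR oppr_ge0 leNgt c0.
Qed.

Lemma positive_nrm_subr c : positive star c -> positive star ((nrm c)%:C%C%:A - c).
Proof.
move=> [sc pc]; split; first by rewrite starB star_scale_real star1 sc.
move=> l h; set l' := (nrm c)%:C%C - l.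
have h' : ~ invertible (c - l'%:A).
  apply: contra_not h => h.
  have -> : (nrm c)%:C%C%:A - c - l%:A = -1 *: (c - l'%:A).
    by rewrite scaleN1r opprB scalerBl addrAC.
  by apply: invertibleZ => //; rewrite oppr_eq0 oner_eq0.
have l'0 := pc _ h'.
have -> : l = (nrm c)%:C%C - l' by rewrite /l' opprB addrC subrK.
rewrite subr_ge0; have : ~~ ((nrm c)%:C%C < `|l'|) by apply/negP => /invertible_nrm_lt.
(* In [R[i]], [0 <= l'] forces [l'] to be real, so the negated strict inequality becomes
   [l' <= nrm c]. *)
rewrite ger0_norm//; move: l'0; rewrite lecE ltcE lecE /=.
by move=> /andP[/eqP -> _]; rewrite eqxx /= leNgt.
Qed.

Lemma state_le_nrm phi c : is_state star phi -> positive star c ->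
  complex.Re (phi c) <= nrm c.
Proof.
move=> [phiD [phiZ [phi1 phipos]]] /positive_nrm_subr /phipos.
rewrite -scaleN1r phiD !phiZ phi1 mulr1 mulN1r lecE => /andP[_].
by rewrite raddfB /= subr_ge0.
Qed.

End CstarAlgebra.

(** * From dominated real functionals to states *)

Section StateOfCone.
Variables (R : realType) (A : algType R[i]) (star : A -> A) (nrm : A -> R).
Hypothesis cA : is_cstar_algebra star nrm.
Local Notation h := ((2^-1 : R)%:C%C : R[i]).

Definition re_part (x : A) : A := h *: (x + star x).
(** This is [(x - star x) / 2i], written so that its real linearity is inherited from [re_part]. *)
Definition im_part (x : A) : A := re_part (- 'i%C *: x).

Lemma scale_half_double (x : A) : h *: (x + x) = x.
Proof.
rewrite scalerDr -scalerDl -rmorphD /=.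
by rewrite (_ : _ + _ = 1 :> R) ?rmorph1 ?scale1r//; lra.
Qed.

Lemma re_partD x y : re_part (x + y) = re_part x + re_part y.
Proof. by rewrite /re_part (star_add cA) addrACA scalerDr. Qed.

Lemma re_partZ (r : R) x : re_part (r%:C%C *: x) = r%:C%C *: re_part x.
Proof. by rewrite /re_part (star_scale_real cA) -scalerDr !scalerA mulrC. Qed.

Lemma re_part_self_adjoint x : star x = x -> re_part x = x.
Proof. by move=> sx; rewrite /re_part sx scale_half_double. Qed.

Lemma im_part_self_adjoint x : star x = x -> im_part x = 0.
Proof.
move=> sx; rewrite /im_part /re_part scaleNr (starN cA) (star_scale_i cA) sx.
by rewrite scaleNr opprK addNr scaler0.
Qed.

Lemma im_partD x y : im_part (x + y) = im_part x + im_part y.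
Proof. by rewrite /im_part scalerDr re_partD. Qed.

Lemma im_partZ (r : R) x : im_part (r%:C%C *: x) = r%:C%C *: im_part x.
Proof. by rewrite /im_part scalerA mulrC -scalerA re_partZ. Qed.

Lemma re_part_i x : re_part ('i%C *: x) = - im_part x.
Proof.
by rewrite /im_part scaleNr -(scaleN1_real (_ *: x)) re_partZ scaleN1_real opprK.
Qed.

Lemma im_part_i x : im_part ('i%C *: x) = re_part x.
Proof. by rewrite /im_part scalerA mulNr -(expr2 'i%C) sqr_i opprK scale1r. Qed.

(** Complex homogeneity is checked on real scalars and on ['i]. For positive [c], [nrm c - psi c =
    psi (nrm c - c) <= nrm (nrm c - c) <= nrm c], so [psi c >= 0]. *)
Lemma state_of_dominated psi : real_linear psi -> (forall x, psi x <= nrm x) ->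
  psi 1 = 1 ->
  is_state star (fun x => (psi (re_part x))%:C%C + 'i%C * (psi (im_part x))%:C%C).
Proof.
move=> [psiD psiZ] psile psi1; set phi := fun x => _.
have phiD x y : phi (x + y) = phi x + phi y.
  by rewrite /phi re_partD im_partD !psiD !rmorphD mulrDr addrACA.
have phiZr (r : R) x : phi (r%:C%C *: x) = r%:C%C * phi x.
  by rewrite /phi re_partZ im_partZ !psiZ !rmorphM /= mulrDr; congr (_ + _); rewrite mulrCA.
have phiZi x : phi ('i%C *: x) = 'i%C * phi x.
  rewrite /phi re_part_i im_part_i -scaleN1_real psiZ mulN1r rmorphN mulrDr mulrA.
  by rewrite -(expr2 'i%C) sqr_i mulN1r addrC.
have psi0 : psi 0 = 0 by have := psiZ 0 0; rewrite scaler0 mul0r.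
split=> //; split; last split.
- move=> k x; rewrite [k]complexE scalerDl phiD -scalerA phiZi !phiZr mulrDl mulrA.
  by [].
- rewrite /phi re_part_self_adjoint ?(star1 cA)// im_part_self_adjoint ?(star1 cA)//.
  by rewrite psi1 psi0 rmorph0 mulr0 addr0.
- move=> c pc; have [sc _] := pc.
  rewrite /phi re_part_self_adjoint// im_part_self_adjoint// psi0 rmorph0 mulr0 addr0.
  rewrite lecR; have := psile ((nrm c)%:C%C%:A - c); have := positive_nrmB cA pc.
  by rewrite psiD psiZ psi1 -scaleN1_real psiZ; lra.
Qed.

Lemma exists_norming_state (c : A) (W : set A) : star c = c ->
  W 0 -> (forall x y, W x -> W y -> W (x + y)) -> (forall (k : R[i]) x, W x -> W (k *: x)) ->
  (forall (s : R) w, 0 <= s -> W w ->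
     nrm c + s <= nrm (c + s%:C%C%:A + re_part w)) ->
  exists phi, [/\ is_state star phi, phi c = (nrm c)%:C%C & forall w, W w -> phi w = 0].
Proof.
move=> sc W0 WD WZ Wc.
(* The cone generated by [(c, nrm c)], [(1, 1)] and all [(re_part w, 0)]. *)
pose G : set (A * R) := [set km | exists s s' w, [/\ 0 <= s, 0 <= s', W w &
  km = (s%:C%C *: c + s'%:C%C%:A + re_part w, s * nrm c + s')]].
have coneG : convex_cone G.
  split.
  - exists 0, 0, 0; split => //.
    by rewrite /re_part (star0 cA) rmorph0 !scale0r !add0r scaler0 mul0r addr0.
  - move=> k k' m m' [s [s' [w [s0 s'0 Ww [-> ->]]]]] [t [t' [v [t0 t'0 Wv [-> ->]]]]].
    exists (s + t), (s' + t'), (w + v); split; rewrite ?addr_ge0//; first exact: WD.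
    congr (_, _); last by ring.
    by rewrite re_partD !rmorphD !scalerDl addrACA; congr (_ + _); rewrite addrACA.
  - move=> t k m t0 [s [s' [w [s0 s'0 Ww [-> ->]]]]].
    exists (t * s), (t * s'), (t%:C%C *: w); split.
    + exact: mulr_ge0 (ltW t0) s0.
    + exact: mulr_ge0 (ltW t0) s'0.
    + exact: WZ.
    + congr (_, _); last by ring.
      by rewrite re_partZ !scalerDr !scalerA !rmorphM.
have snrm : sublinear nrm.
  split; first exact: nrm_triangle cA.
  by move=> t x t0; rewrite (nrm_scale_real cA) gtr0_norm.
have Gnrm k m : G (k, m) -> m <= nrm k.
  move=> [s [s' [w [s0 s'0 Ww [-> ->]]]]].
  (* For [s = 0], the term [nrm c] cancels by the triangle inequality; for [s > 0], the hypothesis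
     is applied after division by [s]. *)
  move: s0; rewrite le_eqVlt => /predU1P[<-|s0].
    have := Wc _ _ s'0 Ww; rewrite -addrA rmorph0 scale0r mul0r !add0r.
    by have := nrm_triangle cA c (s'%:C%C%:A + re_part w); lra.
  have sn0 : s != 0 by rewrite gt_eqF.
  have sV0 : 0 <= s^-1 by rewrite invr_ge0 ltW.
  have := Wc _ _ (mulr_ge0 sV0 s'0) (WZ s^-1%:C%C _ Ww).
  rewrite -(ler_pM2l s0) mulrDr mulrA divff// mul1r => /le_trans; apply.
  rewrite -{1}(gtr0_norm s0) -(nrm_scale_real cA) !scalerDr re_partZ scale_realK//.
  by rewrite rmorphM -scalerA scale_realK.
have [psi [psilin psile psiG]] := hahn_banach_cone snrm coneG Gnrm.
have re0 : re_part 0 = 0 by rewrite re_part_self_adjoint ?(star0 cA).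
have psi1 : psi 1 = 1.
  apply/eqP; rewrite eq_le; apply/andP; split; first by rewrite -[leRHS](nrm1 cA).
  apply: psiG; exists 0, 1, 0; split => //.
  by rewrite re0 rmorph0 rmorph1 scale0r scale1r mul0r !add0r addr0.
have psic : psi c = nrm c.
  apply/eqP; rewrite eq_le psile; apply: psiG; exists 1, 0, 0; split => //.
  by rewrite re0 rmorph0 rmorph1 scale0r scale1r mul1r !addr0.
have [psiD psiZ] := psilin.
have psi0 : psi 0 = 0 by have := psiZ 0 0; rewrite scaler0 mul0r.
(* The constraint at [w] and at [- w] gives both signs; the imaginary part is reached through
   [- 'i *: w], also in [W]. *)
have psiW w : W w -> psi (re_part w) = 0.
  have le0 v : W v -> 0 <= psi (re_part v).
    move=> Wv; apply: psiG; exists 0, 0, v; split => //.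
    by rewrite rmorph0 !scale0r mul0r !add0r.
  move=> Ww; have := le0 _ Ww; have := le0 _ (WZ (-1)%:C%C _ Ww).
  by rewrite re_partZ psiZ; lra.
exists (fun x => (psi (re_part x))%:C%C + 'i%C * (psi (im_part x))%:C%C); split.
- exact: state_of_dominated.
- by rewrite re_part_self_adjoint// im_part_self_adjoint// psi0 rmorph0 mulr0 addr0 psic.
- by move=> w Ww; rewrite !psiW ?rmorph0 ?mulr0 ?addr0//; exact: WZ.
Qed.

End StateOfCone.

(** * Orthogonality and best approximation in Hilbert modules *)

Section HilbertModule.
Variables (R : realType) (A : algType R[i]) (star : A -> A) (nrm : A -> R).
Variables (E : lmodType R[i]) (act : E -> A -> E) (ip : E -> E -> A).
Hypothesis cA : is_cstar_algebra star nrm.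
Hypothesis hE : is_hilbert_module star nrm act ip.

Lemma ip_addl x y z : ip (x + y) z = ip x z + ip y z.
Proof. by rewrite (ip_adj hE z) (ip_addr hE) (star_add cA) -!(ip_adj hE). Qed.

Lemma ip_scalel_real (r : R) x y : ip (r%:C%C *: x) y = r%:C%C *: ip x y.
Proof. by rewrite (ip_adj hE y) (ip_scaler hE) (star_scale_real cA) -(ip_adj hE). Qed.

Lemma ipD_real (t : R) u f : let v := u + t%:C%C *: f in
  ip v v = ip u u + (2 * t)%:C%C *: re_part star (ip u f) + (t ^+ 2)%:C%C *: ip f f.
Proof.
rewrite /= !ip_addl !(ip_addr hE) !ip_scalel_real !(ip_scaler hE) -!addrA; congr (_ + _).
rewrite addrA -scalerDr /re_part -(ip_adj hE) !scalerA -!rmorphM.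
by rewrite -expr2 mulrAC divff ?mul1r// pnatr_eq0.
Qed.

(* First-order expansion of [|u + t f|^2] as [t] tends to [0]. *)
Lemma orthogonal_nrm_re u f (s : R) : 0 <= s ->
  (forall t : R, nrm (ip u u) <= nrm (ip (u + t%:C%C *: f) (u + t%:C%C *: f))) ->
  nrm (ip u u) + s <= nrm (ip u u + s%:C%C%:A + re_part star (ip u f)).
Proof.
move=> s0 orth; set c := ip u u in orth *; set w := re_part _ _; set N := nrm (_ + w).
rewrite leNgt; apply/negP => ltN.
set D := nrm (ip f f).
have D0 : 0 <= D := nrm_ge0 cA _.
(* The square plus [s] is split as [(1 - 2t) (c + s) + 2t (c + s + w) + t ^ 2 <f|f>]; [t <= 1/2]
   keeps the first coefficient nonnegative. *)
have bound (t : R) : 0 < t -> t <= 2^-1 -> nrm c + s - N <= t * D.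
  move=> t0 t1; have := orth t; have := positive_nrmD cA (ip_pos hE (u + t%:C%C *: f)) s0.
  rewrite ipD_real -/c -/w -/D.
  set x := c + _ + _.
  have -> : x + s%:C%C%:A = (1 - 2 * t)%:C%C *: (c + s%:C%C%:A)
      + ((2 * t)%:C%C *: (c + s%:C%C%:A + w) + (t ^+ 2)%:C%C *: ip f f).
    rewrite rmorphB rmorph1 scalerBl scale1r [in RHS](scalerDr _ _ w) !addrA subrK.
    by rewrite /x [LHS]addrAC; congr (_ + _); rewrite addrAC.
  have := nrm_triangle cA ((1 - 2 * t)%:C%C *: (c + s%:C%C%:A))
    ((2 * t)%:C%C *: (c + s%:C%C%:A + w) + (t ^+ 2)%:C%C *: ip f f).
  have := nrm_triangle cA ((2 * t)%:C%C *: (c + s%:C%C%:A + w)) ((t ^+ 2)%:C%C *: ip f f).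
  have := nrm_triangle cA c s%:C%C%:A.
  rewrite !(nrm_scale_real cA) (nrm1 cA) -/N -/D.
  rewrite (ger0_norm s0) !ger0_norm; [|nra|nra|nra].
  nra.
(* This [t] makes [t * D] smaller than the gap [nrm c + s - N]. If it exceeds 1/2, the gap exceeds
   [D + 1] and the bound at 1/2 already fails. *)
pose t := (nrm c + s - N) / (2 * (D + 1)).
have tE : t * (2 * (D + 1)) = nrm c + s - N by rewrite divfK//; lra.
have t0 : 0 < t by apply: divr_gt0; lra.
have tD : 0 <= t * D by apply: mulr_ge0 => //; exact: ltW.
have [t1|t1] := leP t 2^-1; first by have := bound t t0 t1; lra.
by have := bound 2^-1; rewrite invr_gt0 ltr0n lexx => /(_ isT isT); nra.
Qed.

Lemma exists_orthogonal_state u (F : set E) : lin_subspace F ->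
  (forall f, F f -> nrm (ip u u) <= nrm (ip (u + f) (u + f))) ->
  exists phi, [/\ is_state star phi, phi (ip u u) = (nrm (ip u u))%:C%C &
    forall f, F f -> phi (ip u f) = 0].
Proof.
move=> [F0 [FD FZ]] orth.
have [| | | | |phi [sphi phic phiW]] :=
    @exists_norming_state R A star nrm cA (ip u u) [set ip u f | f in F].
- by rewrite -(ip_adj hE).
- by exists 0 => //; have := ip_scaler hE 0 u 0; rewrite !scale0r.
- by move=> _ _ [f Ff <-] [g Fg <-]; exists (f + g); [exact: FD|exact: ip_addr hE _ _ _].
- by move=> k _ [f Ff <-]; exists (k *: f); [exact: FZ|exact: ip_scaler hE _ _ _].
- by move=> s _ s0 [f Ff <-]; apply: orthogonal_nrm_re => // t; apply: orth; exact: FZ.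
by exists phi; split => // f Ff; apply: phiW; exists f.
Qed.

(** Zorn's lemma applies because two vectors of a chain's union lie in a common member. It provides
    a basis over which the supremum in [Mfun] is attained below. *)
Lemma exists_onb phi (F : set E) : exists S, onb ip phi F S.
Proof.
have [|S [oS maxS]] := @Zorn_bigcup E [set S | Defs.orthonormal ip phi F S].
  move=> H HO Hc; split.
    by move=> x [X HX Xx]; exact: (HO _ HX).1 _ Xx.
  move=> x y [X HX Xx] [Y HY Yy].
  case: (Hc _ _ HX HY) => XY.
    by apply: (HO _ HY).2 => //; exact: XY.
  by apply: (HO _ HX).2 => //; exact: XY.
exists S; split => // S' oS' SS'; apply: contrapT => S'S.
exact: maxS S' (conj SS' S'S) oS'.
Qed.

Lemma hnorm_sqr x : hnorm nrm ip x ^+ 2 = nrm (ip x x).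
Proof. by rewrite sqr_sqrtr ?(nrm_ge0 cA). Qed.

Lemma dist_best_approx e (F : set E) f0 : F f0 ->
  (forall f, F f -> hnorm nrm ip (e - f0) <= hnorm nrm ip (e - f)) ->
  dist nrm ip e F = hnorm nrm ip (e - f0).
Proof.
move=> Ff0 best; apply/eqP; rewrite eq_le; apply/andP; split.
  apply: ge_inf; last by exists f0.
  by exists (hnorm nrm ip (e - f0)) => _ [f Ff <-]; exact: best.
apply: lb_le_inf; first by exists (hnorm nrm ip (e - f0)), f0.
by move=> _ [f Ff <-]; exact: best.
Qed.

End HilbertModule.

(** * The maximum formula for the squared distance *)

Unset Implicit Arguments.

Theorem theorem4p6 (R : realType) (A : algType R[i]) (star : A -> A)
  (nrm : A -> R) (E : lmodType R[i]) (act : E -> A -> E) (ip : E -> E -> A)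
  (e : E) (F : set E) (f0 : E) :
  is_cstar_algebra star nrm ->
  is_hilbert_module star nrm act ip ->
  lin_subspace F -> F f0 ->
  (forall f, F f -> hnorm nrm ip (e - f0) <= hnorm nrm ip (e - f)) ->
  (exists phi : A -> R[i], is_state star phi /\
     Mfun ip e f0 F phi = ((dist nrm ip e F) ^+ 2)%:E) /\
  (forall phi : A -> R[i], is_state star phi ->
     (Mfun ip e f0 F phi <= ((dist nrm ip e F) ^+ 2)%:E)%E).
Proof.
move=> cA hE linF Ff0 best.
rewrite (dist_best_approx Ff0 best) (hnorm_sqr ip cA).
have upper phi : is_state star phi ->
    (Mfun ip e f0 F phi <= (nrm (ip (e - f0) (e - f0)))%:E)%E.
  move=> sphi; apply: ge_ereal_sup => _ [S oS <-].
  apply: (@le_trans _ _ (complex.Re (phi (ip (e - f0) (e - f0))))%:E).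
    by apply: geeDl; rewrite oppe_le0; apply: esum_ge0 => x _; rewrite lee_fin sqr_ge0.
  by rewrite lee_fin (state_le_nrm cA sphi)//; exact: ip_pos hE _.
split=> //.
have [F0 [FD FZ]] := linF.
have [f Ff|phi [sphi phic phiF]] := exists_orthogonal_state cA hE linF (u := e - f0).
  (* [(e - f0) + f = e - (f0 - f)] is a competitor for the best approximation. *)
  have Fg : F (f0 - f) by apply: FD => //; rewrite -scaleN1r; exact: FZ.
  have := best _ Fg; rewrite ler_sqrt ?(nrm_ge0 cA)// opprB addrA.
  by rewrite addrAC.
exists phi; split => //; apply/eqP; rewrite eq_le upper//=.
have [S oS] := exists_onb ip phi F.
apply: ereal_sup_ubound; exists S => //.
(* Every coefficient against a vector of [F] vanishes, so any basis gives the value [phi <u|u>]. *)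
rewrite esum1 ?sube0; first by rewrite phic.
by move=> x Sx; rewrite phiF ?/cabs ?normr0 ?expr0n//; exact: oS.1.1.
Qed.
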